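(* Let $\mathbf{A}$ be a submonoid of the monoid $(\mathbf{P}_{\mathbf{PU}}, \circ)$ and let $$\mathbf{X} := \{(\mathbb{R}^+, g \circ d^+) : g \in \mathbf{A}\}.$$ Then the equality $\mathbf{P}_{\mathbf{X}} = \mathbf{A}$ holds.
   Context: $\mathbb{R}^+ = [0,\infty)$. The ultrametric $d^+ : \mathbb{R}^+ \times \mathbb{R}^+ \to \mathbb{R}^+$ is defined by $d^+(p,q) = 0$ if $p=q$ and $d^+(p,q) = \max\{p,q\}$ otherwise. A pseudoultrametric on a nonempty set $X$ is a function $d : X \times X \to \mathbb{R}^+$ such that $d(x,x)=0$, $d(x,y)=d(y,x)$ and $d(x,y) \leqslant \max\{d(x,z), d(z,y)\}$ for all $x,y,z \in X$; then $(X,d)$ is a pseudoultrametric space. A function $f : \mathbb{R}^+ \to \mathbb{R}^+$ is pseudoultrametric-preserving if $f \circ d$ (the mapping $(x,y) \mapsto f(d(x,y))$) is a pseudoultrametric on $X$ for every pseudoultrametric space $(X,d)$. $\mathbf{P}_{\mathbf{PU}}$ is the set of all pseudoultrametric-preserving functions; it is a monoid under function composition $\circ$ with identity $\mathrm{Id}_{\mathbb{R}^+}$. A submonoid of a monoid is a nonempty subset closed under the operation and containing the identity element of the monoid. For a class $\mathbf{X}$ of pseudoultrametric spaces, $\mathbf{P}_{\mathbf{X}}$ is the set of all functions $f : \mathbb{R}^+ \to \mathbb{R}^+$ such that $(Y, f \circ \rho) \in \mathbf{X}$ whenever $(Y,\rho) \in \mathbf{X}$. *)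

(* Defs.v *)
From HB Require Import structures.
From mathcomp Require Import all_boot all_order all_algebra.
From mathcomp Require Import boolp classical_sets reals interval_inference.

Set Implicit Arguments.
Unset Strict Implicit.
Unset Printing Implicit Defensive.

Import Order.TTheory GRing.Theory Num.Theory.
Local Open Scope ring_scope.
Local Open Scope classical_set_scope.

Notation Rplus R := {nonneg R}.

Section Spaces.
Context {R : realType}.

Definition dplus (pq : Rplus R * Rplus R) : Rplus R :=
  if pq.1 == pq.2 then 0%:nng else Order.max pq.1 pq.2.

Record pseudoultrametric (X : Type) (d : X * X -> Rplus R) : Prop :=
  Pseudoultrametric {
    pum_refl : forall x, d (x, x) = 0%:nng;
    pum_sym : forall x y, d (x, y) = d (y, x);
    pum_strong : forall x y z, d (x, y) <= Order.max (d (x, z)) (d (z, y)) }.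

(* A bare pair (X, d). The axioms are not bundled, since [(Y, f \o rho)] has to
   make sense for an arbitrary [f] before it is known to belong to a class. *)
Record dspace : Type := DSpace {
  carrier : Type;
  dist : carrier * carrier -> Rplus R }.

(* A plain predicate rather than a [set]: [set dspace] would force the universe
   of carriers strictly below the one of [Rplus R], and [Rplus R] itself could
   then not carry a [dspace]. *)
Definition dclass := dspace -> Prop.

Definition PU : dclass :=
  fun S => inhabited (carrier S) /\ pseudoultrametric (@dist S).

Definition PUpreserving : set (Rplus R -> Rplus R) :=
  [set f : Rplus R -> Rplus R | forall (X : Type) (d : X * X -> Rplus R),
     PU (DSpace d) -> PU (DSpace (f \o d))].

Definition preserving (C : dclass) : set (Rplus R -> Rplus R) :=
  [set f : Rplus R -> Rplus R | forall (Y : Type) (rho : Y * Y -> Rplus R),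
     C (DSpace rho) -> C (DSpace (f \o rho))].

Definition dplus_class (A : set (Rplus R -> Rplus R)) : dclass :=
  fun S => exists2 g, A g & S = DSpace (g \o dplus).

End Spaces.

Arguments dspace R : clear implicits.
Arguments dclass R : clear implicits.
Arguments dplus R : clear implicits.
Arguments PU R : clear implicits.
Arguments PUpreserving R : clear implicits.

(* [A] is a submonoid of the monoid with carrier [M] (a subset of the ambient
   type [T]), operation [op] and identity [e]. *)
Definition submonoid (T : Type) (op : T -> T -> T) (e : T) (M A : set T) : Prop :=
  [/\ A `<=` M, A !=set0, (forall x y, A x -> A y -> A (op x y)) & A e].

Lemma submonoid_PUpreserving (R : realType) :
  submonoid (fun f g : Rplus R -> Rplus R => f \o g) id setT (PUpreserving R).
Proof.
split=> //; first by exists id => X d.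
by move=> f g Pf Pg X d PUd; apply: (Pf _ (g \o d)); apply: Pg.
Qed.

Lemma PU_dplus (R : realType) : PU R (DSpace (dplus R)).
Proof.
split; first exact: (inhabits 0%:nng).
split=> [x|x y|x y z]; rewrite /dist /dplus /=.
- by rewrite eqxx.
- by rewrite eq_sym maxC.
have [_|nxy] := eqVneq x y; first by rewrite -num_le /=; apply: ge0.
have [xz|_] := eqVneq x z.
  by rewrite -xz (negbTE nxy) le_max lexx orbT.
have [->|_] := eqVneq z y; first by rewrite le_max lexx.
by rewrite ge_max !le_max !lexx !orbT.
Qed.

Lemma dplus_class_PU (R : realType) (A : set (Rplus R -> Rplus R)) S :
  A `<=` PUpreserving R -> dplus_class A S -> PU R S.
Proof. by move=> AP [g Ag ->]; apply: (AP _ Ag); apply: PU_dplus. Qed.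

(* Main.v *)
Require Import Defs.
From mathcomp Require Import all_boot all_order all_algebra.
From mathcomp Require Import boolp classical_sets reals interval_inference.
Import Order.TTheory.
Local Open Scope ring_scope.
Local Open Scope classical_set_scope.

(** Every [p] is a distance of [d^+], namely [d^+(p, 0) = p]; hence
    [f \o d^+ = g \o d^+] forces [f = g]. If [f] preserves the class, apply this
    to the space [f \o d^+], where [d^+] is in the class because [Id] is in [A]. *)

Lemma dplusx0 (R : realType) (p : Rplus R) : dplus R (p, 0%:nng) = p.
Proof.
rewrite /dplus /=; case: eqVneq => [//|_].
by apply/max_idPl; rewrite -num_le /=; apply: ge0.
Qed.

Lemma comp_dplus_inj (R : realType) (f g : Rplus R -> Rplus R) :
  f \o dplus R = g \o dplus R -> f = g.
Proof.
move=> fg; apply/funext => p.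
rewrite -(dplusx0 _ p); exact: (congr1 (@^~ (p, 0%:nng)) fg).
Qed.

(* An equality of spaces only yields equal distances up to a cast along a proof
   of [X = X]; proof irrelevance makes that cast trivial. *)
Lemma DSpace_inj (R : realType) (X : Type) (d d' : X * X -> Rplus R) :
  DSpace d = DSpace d' -> d = d'.
Proof.
move=> dd'.
(* With the right-hand side a variable [S], [e] can be eliminated, which leaves a trivial cast. *)
have cast (S : dspace R) (e : DSpace d = S) :
    ecast Y (Y * Y -> Rplus R) (congr1 (@carrier R) e) d = @dist R S.
  by case: S / e.
by have := cast _ dd'; rewrite (Prop_irrelevance (congr1 (@carrier R) dd') erefl).
Qed.

Theorem proposition3p7 (R : realType) (A : set (Rplus R -> Rplus R))
    (hA : submonoid (fun f g : Rplus R -> Rplus R => f \o g) id (PUpreserving R) A) :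
  preserving (dplus_class A) = A.
Proof.
have [_ _ Acomp Aid] := hA.
apply/seteqP; split=> [f fP|f Af Y rho [g Ag gE]].
  (* [erefl] suffices because [id \o dplus R] is convertible to [dplus R]. *)
  have [g Ag /DSpace_inj/comp_dplus_inj->//] :=
    fP _ (dplus R) (ex_intro2 _ _ id Aid erefl).
exists (f \o g); first exact: Acomp.
(* [Y] is only provably equal to [Rplus R], so [f] is composed with the distance of a whole space
   [S], which avoids any cast; associativity of [\o] holds by conversion. *)
exact: (congr1 (fun S => DSpace (f \o @dist R S)) gE).
Qed.
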